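(* Let $(\Omega,\mathcal{F},P)$ be a probability space and $X$ a scalar random variable with distribution $\pi$ and upper bound $\ell\in\mathbb{R}$ with $\mathbb{P}_\pi[X\le \ell]=1$. Let $g$ be a closed convex function with $g(1)=0$, let $\beta\ge 0$, and let $\mathrm{ER}_{g,\beta}$ be the $g$-entropic risk measure with divergence level $\beta$. Suppose the convex conjugate $g^*$ of $g$ is real-valued, $g^*:\mathbb{R}\to\mathbb{R}$. Define $L(x,\mu,t) = t\left(\mu + g^*\left(\frac{x}{t}-\mu+\beta\right)\right)$ and suppose $u_b: D\subset\mathbb{R}^2\to\mathbb{R}$ is a function with $\mathbb{P}_{\pi}[L(X,\mu,t)\le u_b(\mu,t)] = 1$ for all $\mu\in\mathbb{R}$, $t>0$. For $N$ independent samples $x_1,\dots,x_N$ of $X$, let $\zeta^*_N(\mu,t)=\max_{1\le k\le N} L(x_k,\mu,t)$ (the solution of $\min_\zeta \zeta$ s.t. $\zeta\ge L(x_i,\mu,t)$ for all $i$). Then for all $\epsilon\in[0,1]$, \[ \mathbb{P}^N_{\pi}\left[\mathrm{ER}_{g,\beta}(X) \le \inf_{t>0,\ \mu\in\mathbb{R}} \zeta^*_N(\mu,t)(1-\epsilon) + u_b(\mu,t)\epsilon\right] \ge 1-(1-\epsilon)^N. \]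
   Context: The $g$-entropic risk measure with divergence level $\beta$ is $\mathrm{ER}_{g,\beta}(X) = \sup_{Q\in\mathcal{P}} \mathbb{E}_Q[X]$, where $\mathcal{P} = \{Q : Q \ll P,\ \int g(\frac{dQ}{dP})\,dP \le \beta\}$, $Q\ll P$ denotes absolute continuity and $\frac{dQ}{dP}$ the Radon–Nikodym derivative. The convex conjugate is $g^*(y)=\sup_x(xy-g(x))$. $\mathbb{P}^N_{\pi}$ is the $N$-fold product measure governing the i.i.d. sample. *)

(* Defs.v *)
From HB Require Import structures.
From mathcomp Require Import all_boot all_order all_algebra.
From mathcomp Require Import all_classical all_reals all_analysis.
Set Implicit Arguments. Unset Strict Implicit. Unset Printing Implicit Defensive.
Import Order.TTheory GRing.Theory Num.Theory.
Import numFieldTopology.Exports numFieldNormedType.Exports.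
Local Open Scope classical_set_scope.
Local Open Scope ring_scope.

Section defs.
Context {R : realType}.

Definition econvex (g : R -> \bar R) : Prop :=
  forall (x y lam : R), (0 <= lam <= 1)%R ->
    (g (lam * x + (1 - lam) * y)%R <= lam%:E * g x + (1 - lam)%:E * g y)%E.

Definition eclosed_fun (g : R -> \bar R) : Prop :=
  forall a : R, @closed R^o [set x | (g x <= a%:E)%E].

Definition eproper (g : R -> \bar R) : Prop := forall x, (-oo < g x)%E.

Definition gconj (g : R -> \bar R) (y : R) : \bar R :=
  ereal_sup (range (fun x : R => ((x * y)%:E - g x)%E)).

(* L(x, mu, t) = t (mu + g^*(x/t - mu + beta)), g^* assumed real-valued *)
Definition Lgen (g : R -> \bar R) (beta x mu t : R) : R :=
  t * (mu + fine (gconj g (x / t - mu + beta))).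

Definition ER {d} {T : measurableType d} (P : probability T R)
  (g : R -> \bar R) (beta : R) (X : T -> R) : \bar R :=
  ereal_sup [set (\int[Q]_w (X w)%:E)%E | Q in
    [set Q : probability T R | Q `<< P /\
      (\int[P]_w g (fine (Radon_Nikodym (charge_of_finite_measure Q) P w))
         <= beta%:E)%E]].

(* zeta^*_N(mu,t) = max_k L(x_k, mu, t)  (= -oo when N = 0) *)
Definition zetaN (g : R -> \bar R) (beta : R) (N : nat) (x : 'I_N -> R)
  (mu t : R) : \bar R :=
  (\big[Order.max/-oo]_(k < N) (Lgen g beta (x k) mu t)%:E)%E.

Definition iid_sample {d d'} {T : measurableType d} {S : measurableType d'}
  (P : probability T R) (X : T -> R) (P' : probability S R) (N : nat)
  (Y : 'I_N -> S -> R) : Prop :=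
  [/\ forall k, measurable_fun setT (Y k),
      forall B : 'I_N -> set R, (forall k, measurable (B k)) ->
        P' (\bigcap_(k in [set: 'I_N]) (Y k @^-1` B k)) =
        (\prod_(k < N) P' (Y k @^-1` B k))%E &
      forall k (B : set R), measurable B -> P' (Y k @^-1` B) = P (X @^-1` B)].

End defs.

(* Main.v *)
(** Weak duality suffices: integrating the Fenchel inequality against a density
    q with [E[g q] <= beta] gives [ER <= E[L(X,mu,t)]].  Since [q >= 0], one may
    replace [X w] in it by any larger number.  If a sample point m has
    [P[X > m] <= eps], use m where [X <= m], so that
    [L(m,mu,t) <= zeta_N(mu,t)], and X itself elsewhere, where
    [L(X,mu,t) <= ub(mu,t)] almost surely; this bounds ER by
    [zeta_N (1 - eps) + ub eps] for all (mu,t) at once.  No sample point is of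
    this kind only if all of them lie in the down-set [{x | P[X > x] > eps}],
    which has mass at most [1 - eps] under the law of X; by independence this
    has probability at most [(1 - eps)^N].  The event of the theorem is
    measurable because its complement is the preimage under the sample of a
    union of open boxes. *)
Require Import Defs.
From HB Require Import structures.
From mathcomp Require Import all_boot all_order all_algebra.
From mathcomp Require Import all_classical all_reals all_analysis.
From mathcomp Require Import measurable_realfun ring lra.
Set Implicit Arguments.
Unset Strict Implicit.
Unset Printing Implicit Defensive.

Import Order.TTheory GRing.Theory Num.Theory.
Import numFieldTopology.Exports numFieldNormedType.Exports.
Local Open Scope classical_set_scope.
Local Open Scope ring_scope.

(** * Convex conjugate: Fenchel inequality and open sublevel sets *)

Lemma fenchel_young (R : realType) (g : R -> \bar R) (q y : R) :
  gconj g y \is a fin_num -> ((q * y)%:E <= (fine (gconj g y))%:E + g q)%E.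
Proof.
move=> gy; rewrite fineK//.
have : ((q * y)%:E - g q <= gconj g y)%E by apply: ereal_sup_ubound; exists q.
(* [g q = -oo] would make the conjugate [+oo] at [y], against its finiteness. *)
case: (g q) => [r| |]; last by rewrite leye_eq => /eqP h; rewrite h in gy.
- by rewrite leeBlDr.
- by rewrite -(fineK gy) addey// leey.
Qed.

(** A supremum of affine functions is convex: for each slope [x], average the Fenchel inequalities
    at [a] and [b]. *)
Lemma gconj_convex (R : realType) (g : R -> \bar R) (a b s : R) :
  (forall y, gconj g y \is a fin_num) -> 0 <= s <= 1 ->
  fine (gconj g (s * a + (1 - s) * b)) <=
  s * fine (gconj g a) + (1 - s) * fine (gconj g b).
Proof.
move=> gf /andP[s0 s1]; rewrite -lee_fin fineK//.
apply: ge_ereal_sup => _ [x _ <-].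
have := fenchel_young x (gf a); have := fenchel_young x (gf b).
case: (g x) => [r| |] /=; rewrite ?lee_fin; last by [].
- by move=> hb ha; nra.
- by move=> _ _; rewrite addeNy leNye.
Qed.

(** A finite convex function is upper semicontinuous: near [y] it lies below its chords to [y - 1]
    and [y + 1]. *)
Lemma gconj_sublevel_open (R : realType) (g : R -> \bar R) (c : R) :
  (forall y, gconj g y \is a fin_num) -> open [set y | fine (gconj g y) < c].
Proof.
move=> gf; rewrite openE => y /= yc.
pose f := fun z => fine (gconj g z).
have fc a b r := @gconj_convex R g a b r gf; rewrite -/(f _) in yc.
pose m := Num.max (Num.max (f (y - 1)) (f (y + 1))) c.
have m1 : f (y - 1) <= m by rewrite /m !le_max lexx.
have m2 : f (y + 1) <= m by rewrite /m !le_max lexx orbT.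
have m3 : c <= m by rewrite /m !le_max lexx orbT.
have mf : 0 < m - f y by rewrite subr_gt0 (lt_le_trans yc).
(* The chords give [f z <= f y + |z - y| (m - f y)] for [|z - y| <= 1], and [e] keeps the right side
   below [c]. Having [c] in the maximum [m] makes the divisor positive. *)
pose e := Num.min 1 ((c - f y) / (m - f y)).
have e0 : 0 < e by rewrite /e lt_min ltr01 divr_gt0// subr_gt0.
exists e => //= z; rewrite /ball/= /e lt_min => /andP[z1].
rewrite ltr_pdivlMr// => z2; rewrite -/(f z).
have [yz|zy] := leP y z.
- have := fc (y + 1) y (z - y); rewrite -!/(f _).
  have -> : (z - y) * (y + 1) + (1 - (z - y)) * y = z by ring.
  rewrite distrC ger0_norm ?subr_ge0// in z1 z2.
  by move=> /(_ _)h; have := h ltac:(lra); nra.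
- have := fc (y - 1) y (y - z); rewrite -!/(f _).
  have -> : (y - z) * (y - 1) + (1 - (y - z)) * y = z by ring.
  rewrite gtr0_norm ?subr_gt0// in z1 z2.
  by move=> /(_ _)h; have := h ltac:(lra); nra.
Qed.

Lemma Lgen_sublevel_open (R : realType) (g : R -> \bar R) (beta mu t c : R) :
  (forall y, gconj g y \is a fin_num) -> 0 < t ->
  open [set x | Lgen g beta x mu t < c].
Proof.
move=> gf t0.
have -> : [set x | Lgen g beta x mu t < c] =
    (fun x => x / t - mu + beta) @^-1` [set y | fine (gconj g y) < c / t - mu].
  by apply/seteqP; split => x /=;
    rewrite /Lgen ltrBrDl ltr_pdivlMr// [_ * t]mulrC.
apply: open_comp; last exact: gconj_sublevel_open.
move=> x _; apply: cvgD; last exact: cvg_cst.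
by apply: cvgB; [apply: cvgM; [exact: cvg_id|exact: cvg_cst]|exact: cvg_cst].
Qed.

(** * Measurability of unions of open boxes *)

(* The union may be uncountable, so each box is shrunk to one with rational
   endpoints. *)
Lemma measurable_bigcup_open_box (R : realType) d (S : measurableType d)
    (N : nat) (Y : 'I_N -> S -> R) (I : Type) (D : set I) (O : I -> set R) :
  (forall k, measurable_fun setT (Y k)) -> (forall i, D i -> open (O i)) ->
  measurable (\bigcup_(i in D) \bigcap_(k in [set: 'I_N]) (Y k @^-1` O i)).
Proof.
move=> mY oO.
pose J (p : rat * rat) : set R := [set` `]ratr p.1, ratr p.2[%R].
(* Boxes that fit in no [O i] count as empty, so the union can range over the countable type of all
   rational boxes. *)
pose B (b : {ffun 'I_N -> rat * rat}) : set S :=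
  if `[< exists2 i, D i & forall k, J (b k) `<=` O i >]
  then \bigcap_(k in [set: 'I_N]) (Y k @^-1` J (b k)) else set0.
suff -> : \bigcup_(i in D) \bigcap_(k in [set: 'I_N]) (Y k @^-1` O i) =
    \bigcup_(b in [set: {ffun 'I_N -> rat * rat}]) B b.
  apply: countable_bigcupT_measurable => [//|b].
  rewrite /B; case: ifP => _; last exact: measurable0.
  apply: fin_bigcap_measurable => [|k _]; first exact: finite_finset.
  by rewrite -[X in measurable X]setTI; apply: mY => //; exact: measurable_itv.
apply/seteqP; split => [s [i Di Os]|s [b _]]; last first.
  rewrite /B; case: asboolP => // -[i Di bO] bs; exists i => // k _.
  exact/bO/bs.
have box k : exists p : rat * rat, J p (Y k s) /\ J p `<=` O i.
  have := oO i Di; rewrite openE => /(_ (Y k s) (Os k Logic.I)) [e /= e0 eO].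
  have [p pY] := @rat_in_itvoo R (Y k s - e) (Y k s) ltac:(lra).
  have [q qY] := @rat_in_itvoo R (Y k s) (Y k s + e) ltac:(lra).
  move: pY qY; rewrite !in_itv/= => /andP[p1 p2] /andP[q1 q2].
  exists (p, q); split; first by rewrite /J/= in_itv/= p2.
  move=> z; rewrite /J/= in_itv/= => /andP[z1 z2]; apply: eO.
  by rewrite /ball/= ltr_norml; lra.
have {}box k := cid (box k).
exists [ffun k => sval (box k)] => //.
rewrite /B; case: asboolP => [_ k _|[]]; first by rewrite ffunE; case: (svalP (box k)).
by exists i => // k; rewrite ffunE; case: (svalP (box k)).
Qed.

(** * Almost-sure bounds and integrability *)

Lemma ae_le_integral d (T : measurableType d) (R : realType)
    (mu : {measure set T -> \bar R}) (f h : T -> \bar R) :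
  measurable_fun setT f -> measurable_fun setT h ->
  {ae mu, forall x, (f x <= h x)%E} ->
  (\int[mu]_x f x <= \int[mu]_x h x)%E.
Proof.
move=> mf mh fh; rewrite integralE [leRHS]integralE leeB//.
- apply: ae_ge0_le_integral => //; [exact: measurable_funepos..|].
  apply: filterS fh => x fhx _.
  (* The singleton domain turns monotonicity of the positive part into a pointwise statement. *)
  by apply: (@funepos_le _ _ [set x]) => [y|]; rewrite inE// => ->.
- apply: ae_ge0_le_integral => //; [exact: measurable_funeneg..|].
  apply: filterS fh => x fhx _.
  by apply: (@funeneg_le _ _ [set x]) => [y|]; rewrite inE// => ->.
Qed.

Lemma funeneg_integral_lty d (T : measurableType d) (R : realType)
    (P : probability T R) (f : T -> \bar R) (c : R) :
  measurable_fun setT f -> {ae P, forall x, ((- c)%:E <= f x)%E} ->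
  (\int[P]_x f^\- x < +oo)%E.
Proof.
move=> mf cf; apply: (@le_lt_trans _ _ (\int[P]_x (cst `|c|%:E) x)%E).
  apply: ae_ge0_le_integral => //;
    [exact: measurable_funeneg|by move=> x _; rewrite lee_fin|].
  apply: filterS cf => x cfx _; rewrite funenegE ge_max lee_fin normr_ge0 andbT.
  by rewrite leeNl (le_trans _ cfx)// -EFinN lee_fin lerN2 ler_norm.
by rewrite integral_cst// [X in (_ * X)%E](probability_setT P) mule1 ltry.
Qed.

Lemma integrable_ae_lower_bounded d (T : measurableType d) (R : realType)
    (P : probability T R) (f : T -> \bar R) (c : R) :
  measurable_fun setT f -> {ae P, forall x, ((- c)%:E <= f x)%E} ->
  (\int[P]_x f x < +oo)%E -> P.-integrable setT f.
Proof.
move=> mf cf foo; have fneg := funeneg_integral_lty mf cf.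
(* The negative part has finite integral, so an infinite positive part would make the whole integral
   [+oo]. *)
have fpos : (\int[P]_x f^\+ x < +oo)%E.
  rewrite ltNge leye_eq; apply/eqP => fy; move: foo; rewrite integralE fy.
  have : (\int[P]_x f^\- x)%E \is a fin_num.
    by rewrite ge0_fin_numE//; exact: integral_ge0.
  by move=> /fineK <-.
apply/integrableP; split => //.
under eq_integral do rewrite -/((abse \o f) _) fune_abse.
rewrite ge0_integralD//; [exact: lte_add_pinfty| |].
- exact: measurable_funepos.
- exact: measurable_funeneg.
Qed.

Lemma probability1_ae d (T : measurableType d) (R : realType)
    (P : probability T R) (A : set T) :
  measurable A -> P A = 1%E -> {ae P, forall x, A x}.
Proof.
move=> mA PA; exists (~` A); split => //; first exact: measurableC.
by rewrite probability_setC// PA subee.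
Qed.

Lemma dominates_ae d (T : measurableType d) (R : realType)
    (Q P : probability T R) (A : set T) :
  Q `<< P -> {ae P, forall x, A x} -> {ae Q, forall x, A x}.
Proof.
by move=> /null_content_dominatesP QP [N [mN N0 AN]]; exists N; split => //; exact: QP.
Qed.

Lemma integrable_ae_upper_bounded d (T : measurableType d) (R : realType)
    (P : probability T R) (f : T -> \bar R) (c : R) :
  measurable_fun setT f -> {ae P, forall x, (f x <= c%:E)%E} ->
  (-oo < \int[P]_x f x)%E -> P.-integrable setT f.
Proof.
move=> mf fc foo.
have mNf : measurable_fun setT (\- f)%E by exact: measurableT_comp.
have cNf : {ae P, forall x, ((- c)%:E <= (\- f)%E x)%E}.
  by apply: filterS fc => x fx; rewrite EFinN leeN2.
have iNf : P.-integrable setT (\- f)%E.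
  apply: (integrable_ae_lower_bounded mNf cNf).
  have : (\int[P]_x - (\- f)%E x = - \int[P]_x (\- f)%E x)%E.
    apply: integralN; apply: fin_num_adde_defl.
    rewrite fin_numN ge0_fin_numE; last exact: integral_ge0.
    exact: funeneg_integral_lty cNf.
  under eq_integral do rewrite oppeK.
  by move=> fE; move: foo; rewrite fE; case: (integral _ _ _) => //= r; rewrite ltry.
by have := integrableN iNf; apply: eq_integrable => // x _ /=; rewrite oppeK.
Qed.

(** * Mass of the points with a large upper tail *)

Section upper_tail.
Context d (T : measurableType d) (R : realType) (P : probability T R).
Variables (X : T -> R) (l eps : R).
Hypotheses (mX : measurable_fun setT X) (Xl : P [set w | X w <= l] = 1%E).
Hypothesis eps01 : 0 <= eps <= 1.

Let tail x := P (X @^-1` `]x, +oo[).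
Let A := [set x | (eps%:E < tail x)%E].

Let mXpre (B : set R) : measurable B -> measurable (X @^-1` B).
Proof. by move=> mB; rewrite -[X in measurable X]setTI; exact: mX. Qed.

Let downA x y : A y -> x <= y -> A x.
Proof.
move=> Ay xy; apply: (lt_le_trans Ay).
apply: le_measure; rewrite ?inE; [exact: mXpre..|].
by move=> w /=; rewrite !in_itv/= !andbT; exact: le_lt_trans.
Qed.

Let tailE x : P (X @^-1` `]-oo, x]) = (1 - tail x)%E.
Proof.
rewrite -probability_setC; last exact: mXpre.
by rewrite preimage_setC setCitvr.
Qed.

Let le_tail x : A x -> (P (X @^-1` `]-oo, x]) <= (1 - eps)%:E)%E.
Proof. by rewrite tailE EFinB => Ax; rewrite leeB// ltW. Qed.

Let itvA : is_interval A.
Proof. by move=> x y _ Ay z /andP[_ zy]; exact: downA zy. Qed.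

Lemma measurable_large_tail : measurable A.
Proof. exact: is_interval_measurable. Qed.

(** Each [x] in [A] has [P[X <= x] <= 1 - eps]. If [A] contains its supremum [a], take [x = a];
    otherwise the events [X <= a - 1/(n+1)] increase to the preimage of [A], and continuity from
    below applies. The supremum exists because the tail vanishes at [l]. *)
Lemma probability_large_tail : (P (X @^-1` A) <= (1 - eps)%:E)%E.
Proof.
have [e0 e1] := andP eps01.
have [[x0 Ax0]|A0] := pselect (A !=set0); last first.
  have -> : A = set0 by apply/seteqP; split => // x Ax; apply: A0; exists x.
  by rewrite preimage_set0 measure0 lee_fin subr_ge0.
have Al : ubound A l.
  move=> x Ax; rewrite leNgt; apply/negP => lx.
  have : A l by exact: downA (ltW lx).
  rewrite /A/= /tail -setCitvl -preimage_setC probability_setC; last exact: mXpre.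
  have -> : X @^-1` `]-oo, l] = [set w | X w <= l].
    by apply/seteqP; split => w /=; rewrite in_itv.
  by rewrite Xl subee// lte_fin ltNge e0.
have supA : has_sup A by split; [exists x0|exists l].
pose a := sup A.
have [Aa|Aa] := pselect (A a).
  apply: le_trans (le_tail Aa); apply: le_measure; rewrite ?inE.
  - exact: mXpre measurable_large_tail.
  - exact: mXpre.
  - by move=> w /= Aw; rewrite in_itv/=; apply: ub_le_sup => //; exists l.
pose F n := X @^-1` `]-oo, a - n.+1%:R^-1].
have AF n : A (a - n.+1%:R^-1).
  have [y Ay ay] := @sup_adherent _ A n.+1%:R^-1 ltac:(by rewrite invr_gt0) supA.
  exact: downA Ay (ltW ay).
have FE : X @^-1` A = \bigcup_n F n.
  apply/seteqP; split => [w /= Aw|w [n _]]; last first.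
    by rewrite /F/= in_itv/=; exact: downA.
  have wa : X w < a.
    rewrite lt_neqAle ub_le_sup ?andbT//; last by exists l.
    by apply/eqP => wa; apply: Aa; rewrite -wa.
  have aw : 0 < a - X w by rewrite subr_gt0.
  have [n _ /(_ n (leqnn n)) nw] := near_infty_natSinv_lt (PosNum aw).
  by exists n => //; rewrite /F/= in_itv/= lerBrDr -lerBrDl ltW.
have mF n : measurable (F n) by exact: mXpre.
have mUF : measurable (\bigcup_n F n) by exact: bigcup_measurable.
have ndF : nondecreasing_seq F.
  move=> m n mn; apply/subsetPset => w; rewrite /F/= !in_itv/= => /le_trans; apply.
  by rewrite lerB// lef_pV2 ?posrE// ler_nat.
rewrite FE; have cF := @nondecreasing_cvg_mu _ _ _ P F mF mUF ndF.
rewrite -(cvg_lim _ cF)//; apply: lime_le; first by apply/cvg_ex; eexists; exact: cF.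
by apply: nearW => n; exact: le_tail.
Qed.

End upper_tail.

(** * Weak duality for the entropic risk measure *)

Section weak_duality.
Context d (T : measurableType d) (R : realType) (P : probability T R).
Variables (g : R -> \bar R) (beta : R) (X : T -> R) (l : R).
Hypotheses (mX : measurable_fun setT X) (Xl : P [set w | X w <= l] = 1%E).
Hypotheses (cg : eclosed_fun g) (gf : forall y, gconj g y \is a fin_num).

(** Closedness of [g] is lower semicontinuity, hence Borel measurability. *)
Let mg : measurable_fun setT g.
Proof.
apply: lower_semicontinuous_measurable; apply/lower_semicontinuousP => a.
have -> : [set x | (a%:E < g x)%E] = ~` [set x | (g x <= a%:E)%E].
  by apply/seteqP; split => x /=; [move=> + /le_lt_trans h => /h; rewrite ltxx|
    move=> /negP; rewrite -ltNge].
by rewrite openC; exact: cg.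
Qed.

(* As a density is nonnegative, replacing X w by a larger x only weakens the
   Fenchel inequality; this is what makes up for g^* not being monotone. *)
Let pointwise mu t u w x q : 0 < t -> 0 <= q -> X w <= x ->
  Lgen g beta x mu t <= u ->
  ((X w * q)%:E <=
   (u - t * mu)%:E + (t%:E * g q + (t * (mu - beta) * q)%:E))%E.
Proof.
move=> t0 q0 Xx Lu.
have := fenchel_young q (gf (x / t - mu + beta)).
move: Lu; rewrite /Lgen; set y := _ + beta; set f := fine _ => Lu.
(* So [x q = t (q y) + t (mu - beta) q], where Fenchel gives [q y <= f + g q] and [Lu] gives
   [t f <= u - t mu]. *)
have xE : x = t * (y + mu - beta) by rewrite /y; field; rewrite gt_eqF.
case: (g q) => [r| |]; rewrite ?lee_fin; last by [].
- by move=> qy; nra.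
- by move=> _; rewrite gt0_muley ?lte_fin// addye// addey// leey.
Qed.

(** Integrating [pointwise] against a density [q] of mean 1 leaves [E[U] + t (E[g q] - beta)], whose
    last term is at most 0 by the divergence constraint. [U] may depend on [w] so that two different
    bounds can be glued. *)
Lemma ER_le (U : T -> R) (mu t : R) : 0 < t ->
  P.-integrable setT (EFin \o U) ->
  {ae P, forall w, exists2 x, X w <= x & Lgen g beta x mu t <= U w} ->
  (ER P g beta X <= \int[P]_w (U w)%:E)%E.
Proof.
move=> t0 iU XU; apply: ge_ereal_sup => _ [Q [QP Qbeta] <-].
set rn := Radon_Nikodym _ _ in Qbeta.
have rnf w : rn w \is a fin_num by exact: Radon_Nikodym_fin_num.
have irn : P.-integrable setT rn by exact: Radon_Nikodym_integrable.
pose q w := fine (rn w).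
have rnE w : rn w = (q w)%:E by rewrite /q fineK.
have mq : measurable_fun setT q by apply: measurableT_comp => //; exact: measurable_int irn.
have iq : P.-integrable setT (EFin \o q).
  by apply: eq_integrable irn => // w _; rewrite rnE.
have q1 : (\int[P]_w (q w)%:E = 1)%E.
  rewrite -(probability_setT Q).
  have -> : Q setT = (\int[P]_w rn w)%E by
    exact: (@Radon_Nikodym_integral _ _ _
      (charge_of_finite_measure Q) P setT QP measurableT).
  by apply: eq_integral => w _; rewrite rnE.
(* The derivative is taken of a charge, so its sign comes from almost-everywhere agreement with the
   nonnegative derivative of the measure. *)
have q0 : {ae P, forall w, 0 <= q w}.
  have := ae_eq_Radon_Nikodym_SigmaFinite QP measurableT.
  apply: filterS => w /(_ Logic.I) fw.
  by rewrite -lee_fin -rnE -[rn w]fw; exact: Radon_Nikodym_SigmaFinite.f_ge0.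
have iG : P.-integrable setT (g \o q).
  (* Fenchel at [y = 0] gives [g >= - g^*(0)]. *)
  apply: (@integrable_ae_lower_bounded _ _ _ _ _ (fine (gconj g 0))).
  - exact: measurableT_comp.
  - apply: aeW => w; have := fenchel_young (q w) (gf 0).
    rewrite mulr0 /=; case: (g (q w)) => [r| |].
    + by rewrite !lee_fin => h; lra.
    + by move=> _; rewrite leey.
    + by [].
  - exact: le_lt_trans Qbeta (ltry _).
(* Apart from this trivial case, the upper bound [l] makes [X] integrable under [Q], as the change
   of measure requires. *)
have [->|XNy] := eqVneq (\int[Q]_w (X w)%:E)%E -oo%E; first by rewrite leNye.
have iX : Q.-integrable setT (EFin \o X).
  apply: (@integrable_ae_upper_bounded _ _ _ _ _ l); [exact/measurable_EFinP| |].
  - apply: (@dominates_ae _ _ _ _ P [set w | ((X w)%:E <= l%:E)%E]) => //.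
    apply: probability1_ae; last by under eq_set do rewrite lee_fin.
    by rewrite -[X in measurable X]setTI; apply: emeasurable_fun_infty_c => //;
      exact/measurable_EFinP.
  - by rewrite ltNye.
rewrite -(Radon_Nikodym_change_of_variables QP)// -/rn.
pose V w := ((U w - t * mu)%:E + (t%:E * g (q w) + (t * (mu - beta) * q w)%:E))%E.
have i1 : P.-integrable setT (fun w => (U w - t * mu)%:E).
  under eq_fun do rewrite EFinB.
  by apply: integrableB => //; exact: finite_measure_integrable_cst.
have i2 : P.-integrable setT (fun w => t%:E * g (q w))%E by exact: integrableZl.
have i3 : P.-integrable setT (fun w => (t * (mu - beta) * q w)%:E).
  by under eq_fun do rewrite EFinM; exact: integrableZl.
have i23 := integrableD measurableT i2 i3.
apply: (@le_trans _ _ (\int[P]_w V w)%E).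
  apply: ae_le_integral.
  - apply: emeasurable_funM; [exact/measurable_EFinP|exact: measurable_int irn].
  - exact: measurable_int (integrableD measurableT i1 i23).
  - apply: filterS2 XU q0 => w [x Xx xU] qw.
    by rewrite rnE -EFinM; exact: pointwise xU.
rewrite integralD// integralD// integralZl//.
under eq_integral do rewrite EFinB.
rewrite integralB//; last exact: finite_measure_integrable_cst.
rewrite integral_cst// [X in (_ - _ * X)%E](probability_setT P) mule1.
under [X in (_ + (_ + X))%E]eq_integral do rewrite EFinM.
rewrite integralZl// q1 mule1.
have Uf := integrable_fin_num measurableT iU.
have Gf := integrable_fin_num measurableT iG.
move: Qbeta; rewrite -[X in (X <= _)%E -> _](fineK Gf) -[X in (_ * X)%E](fineK Gf).
rewrite -(fineK Uf) !lee_fin => Gb.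
have : t * fine (\int[P]_w (g \o q) w)%E <= t * beta by rewrite ler_pM2l.
by lra.
Qed.

End weak_duality.

Lemma ER_le_mixture d (T : measurableType d) (R : realType)
    (P : probability T R) (g : R -> \bar R) (beta : R) (X : T -> R)
    (l m z u mu t eps : R) :
  measurable_fun setT X -> P [set w | X w <= l] = 1%E ->
  eclosed_fun g -> (forall y, gconj g y \is a fin_num) -> 0 < t ->
  eps <= 1 -> (P (X @^-1` `]m, +oo[) <= eps%:E)%E ->
  Lgen g beta m mu t <= z -> {ae P, forall w, Lgen g beta (X w) mu t <= u} ->
  (ER P g beta X <= (z * (1 - eps) + u * eps)%:E)%E.
Proof.
move=> mX Xl cg gf t0 e1 Xm Lz Lu.
have intc r : (\int[P]_w r%:E = r%:E)%E.
  rewrite (integral_cst P measurableT r%:E).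
  by rewrite [X in (_ * X)%E](probability_setT P) mule1.
(* If [u < z], the constant [U = u] suffices, since [u <= z (1 - eps) + u eps]. Otherwise the mean
   [z + (u - z) P(B)] of the glued bound is nondecreasing in [P(B) <= eps]. *)
have [zu|uz] := leP z u; last first.
  apply: (@le_trans _ _ u%:E); last by rewrite lee_fin; nra.
  have := @ER_le _ _ _ P g beta X l mX Xl cg gf (cst u) mu t t0.
  rewrite intc; apply.
  - exact: finite_measure_integrable_cst.
  - by apply: filterS Lu => w Lw; exists (X w).
set B := _ @^-1` _ in Xm.
have mB : measurable B by rewrite -[B]setTI; exact: mX.
pose U w := z + (u - z) * \1_B w.
have iB : P.-integrable setT (fun w => (u - z)%:E * (\1_B w)%:E)%E.
  by apply: integrableZl => //; exact: integrable_indic.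
have iz : P.-integrable setT (fun=> z%:E) by exact: finite_measure_integrable_cst.
have iU : P.-integrable setT (EFin \o U) by exact: (integrableD measurableT iz iB).
have XU : {ae P, forall w, exists2 x, X w <= x & Lgen g beta x mu t <= U w}.
  apply: filterS Lu => w Lw; have [Bw|Bw] := pselect (B w).
    by exists (X w) => //; rewrite /U indicE mem_set// mulr1; lra.
  exists m; last by rewrite /U indicE memNset// mulr0 addr0.
  by rewrite leNgt; apply/negP => mXw; apply: Bw; rewrite /B/= in_itv/= mXw.
apply: (le_trans (ER_le mX Xl cg gf t0 iU XU)).
under eq_integral do rewrite EFinD EFinM.
rewrite integralD//.
rewrite intc integralZl//; last exact: integrable_indic.
rewrite integral_indic// setIT.
have Bf : P B \is a fin_num by exact: fin_num_measure.
rewrite [X in (_ + _ * X)%E](esym (fineK Bf)) -EFinM -EFinD lee_fin.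
move: Xm; rewrite -(fineK Bf) lee_fin => Be.
have : (u - z) * fine (P B) <= (u - z) * eps by rewrite ler_wpM2l// subr_ge0.
by lra.
Qed.

(** * The sample maximum and the event of the theorem *)

(** With at least one sample point the maximum is attained, so the default [-oo] disappears and
    [zetaN] is real. *)
Lemma zetaN_max (R : realType) (g : R -> \bar R) (beta : R) N (x : 'I_N.+1 -> R)
    (mu t : R) :
  exists2 j, zetaN g beta x mu t = (Lgen g beta (x j) mu t)%:E &
    forall k, Lgen g beta (x k) mu t <= Lgen g beta (x j) mu t.
Proof.
pose j := [arg max_(i > ord0) Lgen g beta (x i) mu t]%O.
have jmax k : Lgen g beta (x k) mu t <= Lgen g beta (x j) mu t.
  by rewrite /j; case: arg_maxP => // i _; apply.
exists j => //; apply/eqP; rewrite eq_le; apply/andP; split.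
  by apply: bigmax_le => [|k _]; rewrite ?leNye// lee_fin.
by rewrite /zetaN; apply: (le_bigmax_cond -oo%E (fun k => (Lgen g beta (x k) mu t)%:E)).
Qed.

(** Meant for [a = 1 - eps], which vanishes at [eps = 1], and for [e] the risk measure, which may be
    infinite; hence the degenerate cases. *)
Lemma affine_sublevel_open (R : realType) (f : R -> R) (a b : R) (e : \bar R) :
  (forall c, open [set x | f x < c]) -> 0 <= a ->
  open [set x | ((f x * a + b)%:E < e)%E].
Proof.
move=> fo; rewrite le_eqVlt => /predU1P[<-|a0].
  under eq_set do rewrite mulr0 add0r.
  case: (pselect (b%:E < e)%E) => be.
    by rewrite (_ : mkset _ = setT); [exact: openT|apply/seteqP; split].
  by rewrite (_ : mkset _ = set0); [exact: open0|apply/seteqP; split].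
case: e => [r| |].
- rewrite (_ : mkset _ = [set x | f x < (r - b) / a]) //.
  by apply/seteqP; split => x /=; rewrite lte_fin ltr_pdivlMr// ltrBrDr.
- by rewrite (_ : mkset _ = setT); [exact: openT|apply/seteqP; split => x //= _; rewrite ltry].
- by rewrite (_ : mkset _ = set0); [exact: open0|apply/seteqP; split].
Qed.

Lemma open_sublevel_measurable_fun (R : realType) (f : R -> R) :
  (forall c, open [set x | f x < c]) -> measurable_fun setT f.
Proof.
move=> fo; apply: (measurability _ (RGenInftyO.measurableE R)).
move=> _ [_ [a ->] <-]; rewrite setTI; apply: open_measurable.
by rewrite preimage_itvNyo; exact: fo.
Qed.

Theorem theorem6 (R : realType) (d : measure_display) (T : measurableType d)
  (P : probability T R) (X : T -> R) (l : R)
  (g : R -> \bar R) (beta : R) (ub : R -> R -> R)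
  (d' : measure_display) (S : measurableType d') (P' : probability S R)
  (N : nat) (Y : 'I_N -> S -> R) (eps : R) :
  measurable_fun setT X ->
  P [set w | (X w <= l)%R] = 1%E ->
  econvex g -> eclosed_fun g -> eproper g -> g 1 = 0%E ->
  (0 <= beta)%R ->
  (forall y, gconj g y \is a fin_num) ->
  (forall mu t, (0 < t)%R -> P [set w | (Lgen g beta (X w) mu t <= ub mu t)%R] = 1%E) ->
  iid_sample P X P' Y ->
  (0 <= eps <= 1)%R ->
  ((1 - (1 - eps) ^+ N)%:E <=
   P' [set s | (ER P g beta X <=
     ereal_inf [set (zetaN g beta (fun k => Y k s) mu t * (1 - eps)%:E
                     + (ub mu t * eps)%:E)%E
               | mu in [set: R] & t in [set t : R | (0 < t)%R]])%E])%E.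
Proof.
move=> mX Xl _ cg _ _ _ gf Lub [mY indepY lawY] eps01.
have [e0 e1] := andP eps01.
(* For [N = 0] the claimed lower bound is [1 - 1 = 0]. *)
case: N Y mY indepY lawY => [|N] Y mY indepY lawY.
  by rewrite expr0 subrr measure_ge0.
set E := [set s | _].
(* The values [x] whose own bound at [p = (mu, t)] falls below the risk. As [1 - eps >= 0], the
   bound with the maximum fails at [p] exactly when every sample point lies in [O p]. *)
pose O (p : R * R) : set R :=
  [set x | ((Lgen g beta x p.1 p.2 * (1 - eps) + ub p.1 p.2 * eps)%:E <
            ER P g beta X)%E].
have Lopen mu t c : 0 < t -> open [set x | Lgen g beta x mu t < c].
  exact: Lgen_sublevel_open.
have EC : ~` E = \bigcup_(p in [set p : R * R | 0 < p.2])
    \bigcap_(k in [set: 'I_N.+1]) (Y k @^-1` O p).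
  apply/seteqP; split => [s|s [[mu t] /= t0 Os] Es].
    apply: contra_notP => sO; apply/ereal_infP => _ [mu _ [t /= t0 <-]].
    have [j -> jmax] := zetaN_max g beta (fun k => Y k s) mu t.
    rewrite leNgt; apply/negP => lt; apply: sO; exists (mu, t) => // k _.
    apply: le_lt_trans lt; rewrite lee_fin lerD2r ler_wpM2r// subr_ge0//.
  move: Es; rewrite /E/= => /ereal_infP.
  move=> /(_ _ (ex_intro2 _ _ mu Logic.I (ex_intro2 _ _ t t0 erefl))).
  have [j -> _] := zetaN_max g beta (fun k => Y k s) mu t.
  by rewrite leNgt => /negP; apply; exact: (Os j Logic.I).
have mE : measurable E.
  rewrite -[E]setCK EC; apply: measurableC.
  apply: measurable_bigcup_open_box => // -[mu t] /= t0.
  apply: affine_sublevel_open; last by rewrite subr_ge0.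
  by move=> c; exact: Lopen.
pose A := [set x | (eps%:E < P (X @^-1` `]x, +oo[))%E].
have mA : measurable A by exact: measurable_large_tail.
pose F := \bigcap_(k in [set: 'I_N.+1]) (Y k @^-1` A).
have mF : measurable F.
  apply: fin_bigcap_measurable => [|k _]; first exact: finite_finset.
  by rewrite -[X in measurable X]setTI; exact: mY.
(* Off [F] some [Y k s] has upper tail at most [eps]; it serves as [m] for every [(mu, t)], with the
   sample maximum as [z]. *)
have FE : ~` F `<=` E.
  move=> s /existsNP[k] /not_implyP[_] /negP.
  rewrite -leNgt => Yk; apply/ereal_infP => _ [mu _ [t /= t0 <-]].
  have [j -> jmax] := zetaN_max g beta (fun k => Y k s) mu t.
  apply: (ER_le_mixture mX Xl cg gf t0 e1 Yk (jmax k)).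
  have mL : measurable_fun setT (fun w => Lgen g beta (X w) mu t).
    apply: (measurableT_comp (f := fun x => Lgen g beta x mu t)) => //.
    by apply: open_sublevel_measurable_fun => c; exact: Lopen.
  have LE : [set w | Lgen g beta (X w) mu t <= ub mu t] =
      setT `&` (fun w => Lgen g beta (X w) mu t) @^-1` `]-oo, ub mu t].
    by rewrite setTI; apply/seteqP; split => w /=; rewrite in_itv.
  apply: (probability1_ae _ (Lub mu t t0)).
  by rewrite LE; apply: mL => //; exact: measurable_itv.
apply: (@le_trans _ _ (P' (~` F))); last first.
  by apply: le_measure; rewrite ?inE//; exact: measurableC.
(* Independence and the common law give [P'(F) = P[X in A]^(N+1)]. *)
rewrite probability_setC// EFinB leeB// /F indepY//.
under eq_bigr do rewrite lawY//.
have pf : P (X @^-1` A) \is a fin_num.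
  by apply: fin_num_measure; rewrite -[X in measurable X]setTI; exact: mX.
have := probability_large_tail mX Xl eps01; rewrite -/A -(fineK pf) lee_fin => pe.
rewrite prodEFin lee_fin prodr_const card_ord.
by apply: lerXn2r; rewrite ?nnegrE ?subr_ge0// fine_ge0.
Qed.
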